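(* Let $\mu \in \mathbb{C}$ and let $\boldsymbol{\mu} = (0,0,0,\mu)$. Then the sink constant satisfies $M(\boldsymbol{\mu}) = |t_\mu|$, where $t_\mu$ is a dominant root (a complex root of largest modulus) of the polynomial equation $X^3 - 3X^2 + \mu = 0$.
   Context: Tree and regions. Let $\mathcal{T}$ be the infinite trivalent tree, properly embedded in the hyperbolic plane, dual to the Farey triangulation. Let $\Omega$ be the set of complementary regions of $\mathcal{T}$ (closures of connected components of the complement of $\mathcal{T}$; they are indexed by $\mathbb{Q}\cup\{\infty\}$). Each vertex of $\mathcal{T}$ is met by exactly three regions. For an edge $e$, write $e \leftrightarrow (X,Y;Z,W)$ if $e = X\cap Y$ and $e\cap Z$, $e \cap W$ are the two endpoints of $e$. Markoff maps. For $\boldsymbol{\mu}=(0,0,0,\mu)$, a $\boldsymbol{\mu}$-Markoff map is a function $\phi:\Omega\to\mathbb{C}$ such that (i) for any three regions $X_1,X_2,X_3$ meeting at a vertex, with $x_i=\phi(X_i)$, one has $x_1^2+x_2^2+x_3^2-x_1x_2x_3=\mu$; (ii) for every edge $e\leftrightarrow (X,Y;Z,W)$ one has $\phi(Z)+\phi(W)=\phi(X)\phi(Y)$. Arrows and sinks. Given $\phi$ and an edge $e\leftrightarrow (X,Y;Z,W)$, the edge carries an arrow pointing towards $W$ if $|\phi(Z)|\ge|\phi(W)|$, and an arrow pointing towards $Z$ if $|\phi(Z)|\le|\phi(W)|$ (both arrows in case of equality). A vertex is a sink for $\phi$ if all three incident edges carry an arrow pointing towards it. Sink constant. $M(\boldsymbol{\mu})$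 is the smallest constant $m$ such that for every $\boldsymbol{\mu}$-Markoff map $\phi$ and every three regions $X_1,X_2,X_3$ meeting at a sink of $\phi$, $\min\{|\phi(X_1)|,|\phi(X_2)|,|\phi(X_3)|\}\le m$. *)

(* Defs.v *)
From HB Require Import structures.
From mathcomp Require Import all_boot all_order all_algebra.
From mathcomp Require Import classical_sets reals complex.

Set Implicit Arguments.
Unset Strict Implicit.
Unset Printing Implicit Defensive.

Import Order.TTheory GRing.Theory Num.Theory.
Import ComplexField.Normc.
Local Open Scope ring_scope.

(* The tree T dual to the Farey triangulation, encoded by duality.  A
   complementary region of T surrounds exactly one ideal vertex of the
   triangulation, i.e. one element of QQ u {oo}; [None] stands for oo = 1/0.
   Edges of T correspond to edges of the triangulation: two distinct regions
   p/q and r/s (in lowest terms) share an edge of T iff |ps - qr| = 1.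
   Vertices of T correspond to the ideal triangles: three regions meet at a
   vertex of T iff they are pairwise Farey neighbours. *)
Definition region : Type := option rat.

Definition region_num (X : region) : int := if X is Some q then numq q else 1.
Definition region_den (X : region) : int := if X is Some q then denq q else 0.

Definition share_edge (X Y : region) : Prop :=
  `|region_num X * region_den Y - region_den X * region_num Y| = 1.

Definition meet_at_vertex (X Y Z : region) : Prop :=
  [/\ share_edge X Y, share_edge Y Z & share_edge X Z].

(* e <-> (X, Y; Z, W): the edge e is the intersection of X and Y, and its two
   (distinct) endpoints are the vertices (X, Y, Z) and (X, Y, W). *)
Definition tree_edge (X Y Z W : region) : Prop :=
  [/\ meet_at_vertex X Y Z, meet_at_vertex X Y W & Z <> W].

Section Markoff.
Variable R : realType.
Local Notation C := R[i].

Definition markoff_map (mu : C) (phi : region -> C) : Prop :=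
  (forall X1 X2 X3 : region, meet_at_vertex X1 X2 X3 ->
     phi X1 ^+ 2 + phi X2 ^+ 2 + phi X3 ^+ 2 - phi X1 * phi X2 * phi X3 = mu)
  /\ (forall X Y Z W : region, tree_edge X Y Z W ->
        phi Z + phi W = phi X * phi Y).

(* On the edge e <-> (X, Y; Z, W), an arrow pointing towards W. *)
Definition arrow_towards (phi : region -> C) (X Y Z W : region) : Prop :=
  tree_edge X Y Z W /\ normc (phi Z) >= normc (phi W).

(* The edges incident to the vertex (X1, X2, X3) are X1 n X2, X2 n X3 and
   X1 n X3; the arrow on X1 n X2 pointing to this vertex points towards X3,
   and so on. *)
Definition sink (phi : region -> C) (X1 X2 X3 : region) : Prop :=
  [/\ meet_at_vertex X1 X2 X3,
      forall Z, tree_edge X1 X2 Z X3 -> arrow_towards phi X1 X2 Z X3,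
      forall Z, tree_edge X2 X3 Z X1 -> arrow_towards phi X2 X3 Z X1
    & forall Z, tree_edge X1 X3 Z X2 -> arrow_towards phi X1 X3 Z X2].

Definition sink_bounds (mu : C) : set R :=
  [set m : R | forall (phi : region -> C) (X1 X2 X3 : region),
     markoff_map mu phi -> sink phi X1 X2 X3 ->
     Num.min (normc (phi X1)) (Num.min (normc (phi X2)) (normc (phi X3))) <= m].

(* [is_sink_constant mu M]: M is the smallest element of [sink_bounds mu];
   existence of such a least element is part of the assertion, and M is then
   unique. *)
Definition is_sink_constant (mu : C) (M : R) : Prop :=
  sink_bounds mu M /\ lbound (sink_bounds mu) M.

Definition dominant_root (p : {poly C}) (t : C) : Prop :=
  root p t /\ forall s : C, root p s -> normc s <= normc t.

End Markoff.

(* Main.v *)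
Require Import Defs.
From mathcomp Require Import all_boot all_order all_algebra.
From mathcomp Require Import classical_sets reals complex.
From mathcomp Require Import boolp topology normedtype derive.
From mathcomp Require Import realfun.
From mathcomp Require Import ring lra zify.
Set Implicit Arguments.
Unset Strict Implicit.
Unset Printing Implicit Defensive.
Import Order.TTheory GRing.Theory Num.Theory.
Import ComplexField.Normc.
Import numFieldNormedType.Exports.
Local Open Scope classical_set_scope.
Local Open Scope ring_scope.

(** Upper bound.  At a sink with labels x, y, z put a = x/(yz), b = y/(xz) and
    c = z/(xy).  The vertex relation becomes 1 - (a + b + c) + mu a b c = 0, the
    polar form of 1 - 3 s + mu s^3, whose zeros are the inverses of the roots of
    X^3 - 3 X^2 + mu; the arrow on the edge opposite to z says |c| <= |1 - c|.
    Suppose |t| < k = min(|x|, |y|, |z|).  By Grace's theorem the polar form has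
    no zero with |a|, |b|, |c| <= 1/k, so it is enough to bound these three
    moduli.  Now c is a root of c^2 - c + w - w' = 0 with w = 1/x^2 + 1/y^2 and
    w' = mu/(x y)^2, and by the arrow condition it is the smaller one.  Deform w
    into v w and w' into v^2 w', 0 <= v <= 1: the smaller root is 0 at v = 0, so
    if |c| >= 1/k at v = 1 some intermediate root b has modulus exactly 1/k, and
    (v/(b x^2), v/(b y^2), b) is a forbidden zero of the polar form.

    Lower bound.  (t, t, t) solves the vertex equation, hence extends to a Markoff
    map.  If s and r are the other roots, t s + s r + r t = 0 gives
    (1 + s/t)(1 + r/t) = 1 with s/t and r/t in the unit disc, which forces
    Re (s/t + r/t) <= 1/2, i.e. |t - 1| >= 1: this is the sink condition. *)

(** * Grace's theorem for cubics *)

Section Grace.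
Variable R : rcfType.
Implicit Types u v w d a b c s : R[i].

Lemma normc_ge0 u : 0 <= normc u.
Proof. by case: u => x y; apply: sqrtr_ge0. Qed.

Lemma sqr_normcE u : normc u ^+ 2 = complex.Re u ^+ 2 + complex.Im u ^+ 2.
Proof. by case: u => x y /=; rewrite sqr_sqrtr // addr_ge0 ?sqr_ge0. Qed.

Lemma Re_le_normc u : complex.Re u <= normc u.
Proof.
apply: le_trans (ler_norm _) _; rewrite -(@ler_pXn2r _ 2) ?nnegrE ?normc_ge0 //.
by rewrite sqr_normcE real_normK ?num_real // lerDl sqr_ge0.
Qed.

(* The image of the unit disc under u |-> (1 - u a) / (1 - u s) lies in the
   half-plane of the w with Re ((1 - a^* s) w) > 0. *)
Lemma moebius_half_plane u a s : normc u <= 1 -> normc a < 1 -> normc s < 1 ->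
  0 < complex.Re ((1 - a^*%C * s) * (1 - u * a) * (1 - u * s)^*%C).
Proof.
move=> u1 a1 s1.
have le_as : complex.Re (a^*%C * s) <= normc a * normc s.
  apply: le_trans (Re_le_normc _) _; rewrite normcM.
  by case: (a) => x y /=; rewrite sqrrN.
have := Re_le_normc (u * a); have := Re_le_normc (u * s); rewrite !normcM.
move: le_as (sqr_normcE u) (sqr_normcE a) (sqr_normcE s) u1 a1 s1.
move: (normc_ge0 u) (normc_ge0 a) (normc_ge0 s).
move: (normc u) (normc a) (normc s) => U A S.
case: u a s => [u1 u2] [a1 a2] [s1 s2] /= U0 A0 S0 le_as EU EA ES leU ltA ltS us ua.
set E := (X in 0 < X).
have -> : E = 1 - (1 - U ^+ 2) * (a1 * s1 + a2 * s2) - U ^+ 2 * A ^+ 2 * S ^+ 2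
   - (1 - S ^+ 2) * (u1 * a1 - u2 * a2) - (1 - A ^+ 2) * (u1 * s1 - u2 * s2).
  by rewrite EU EA ES /E; ring.
have h1 : (1 - U ^+ 2) * (a1 * s1 + a2 * s2) <= (1 - U ^+ 2) * (A * S).
  by apply: ler_wpM2l; nra.
have h2 : (1 - S ^+ 2) * (u1 * a1 - u2 * a2) <= (1 - S ^+ 2) * (U * A).
  by apply: ler_wpM2l; nra.
have h3 : (1 - A ^+ 2) * (u1 * s1 - u2 * s2) <= (1 - A ^+ 2) * (U * S).
  by apply: ler_wpM2l; nra.
(* The bound given by h1, h2 and h3 factors as this product. *)
have h : 0 < (1 - A * S) * (1 - U * A) * (1 - U * S).
  by apply: mulr_gt0; [apply: mulr_gt0|]; nra.
by nra.
Qed.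

Lemma Re_mul_conj_gt0 w d : 0 < complex.Re (w * d^*%C) -> 0 < complex.Re (w / d).
Proof.
have [->|d0] := eqVneq d 0; first by rewrite invr0 conjc0.
have n0 : 0 < normc d ^+ 2.
  by rewrite exprn_gt0 // lt_def normc_ge0 andbT; apply: contra_neq d0 => /eq0_normc.
have -> : w * d^*%C = w / d * ((normc d ^+ 2)%:C)%C.
  apply: (mulIf d0); rewrite [RHS]mulrAC divfK // -mulrA; congr (_ * _).
  by rewrite sqr_normcE; case: (d) => x y; simpc; congr (_ +i* _)%C; ring.
case: (w / d) => x y; simpc => /=.
by rewrite pmulr_lgt0.
Qed.

Lemma one_sub_mul_neq0 u s : normc u <= 1 -> normc s < 1 -> 1 - u * s != 0.
Proof.
move=> u1 s1; apply/eqP => /subr0_eq /(congr1 (@normc R)).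
rewrite normcM normc1 => h; have := normc_ge0 s; have := normc_ge0 u; nra.
Qed.

Lemma Re_moebius_gt0 u a s : normc u <= 1 -> normc a < 1 -> normc s < 1 ->
  0 < complex.Re ((1 - a^*%C * s) * ((1 - u * a) / (1 - u * s))).
Proof.
by move=> *; rewrite mulrA; apply/Re_mul_conj_gt0/moebius_half_plane.
Qed.

(** Division by [(1 - v1 * c) * (1 - v2 * c)] leaves a sum of two points of the half-plane of
    [Re_moebius_gt0]. *)
Lemma bipolar_neq0 v1 v2 b c : normc v1 <= 1 -> normc v2 <= 1 ->
  normc b < 1 -> normc c < 1 ->
  (1 - v1 * b) * (1 - v2 * c) + (1 - v2 * b) * (1 - v1 * c) != 0.
Proof.
move=> v11 v21 b1 c1; apply/eqP => h.
have n1 := one_sub_mul_neq0 v11 c1; have n2 := one_sub_mul_neq0 v21 c1.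
have e : (1 - v1 * b) / (1 - v1 * c) + (1 - v2 * b) / (1 - v2 * c) = 0.
  by apply: (mulfI (mulf_neq0 n1 n2)); rewrite mulr0 -h; field; rewrite n1 n2.
have := addr_gt0 (Re_moebius_gt0 v11 b1 c1) (Re_moebius_gt0 v21 b1 c1).
by rewrite -raddfD -mulrDr e mulr0 ltxx.
Qed.

(* Dividing by the product of the three 1 - u_i s gives a sum of three points of
   one open half-plane bounded by a line through 0. *)
Lemma laguerre_cubic_neq0 u1 u2 u3 a s :
  normc u1 <= 1 -> normc u2 <= 1 -> normc u3 <= 1 -> normc a < 1 -> normc s < 1 ->
  (1 - u1 * a) * (1 - u2 * s) * (1 - u3 * s)
  + (1 - u2 * a) * (1 - u1 * s) * (1 - u3 * s)
  + (1 - u3 * a) * (1 - u1 * s) * (1 - u2 * s) != 0.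
Proof.
move=> u11 u21 u31 a1 s1; apply/eqP => h.
have n1 := one_sub_mul_neq0 u11 s1; have n2 := one_sub_mul_neq0 u21 s1.
have n3 := one_sub_mul_neq0 u31 s1.
have e : (1 - u1 * a) / (1 - u1 * s) + (1 - u2 * a) / (1 - u2 * s)
   + (1 - u3 * a) / (1 - u3 * s) = 0.
  apply: (mulfI (mulf_neq0 (mulf_neq0 n1 n2) n3)); rewrite mulr0 -h.
  by field; rewrite n1 n2 n3.
have := addr_gt0 (addr_gt0 (Re_moebius_gt0 u11 a1 s1) (Re_moebius_gt0 u21 a1 s1))
  (Re_moebius_gt0 u31 a1 s1).
by rewrite -!raddfD -!mulrDr e mulr0 ltxx.
Qed.

(** The expression is the polar form [p - q * (b + c) + r * (b * c)] of the quadratic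
    [p - 2 * q * s + r * s ^+ 2], which is the Laguerre sum at [a] and so has no zero in the open
    unit disc. Factoring it as [p * (1 - v1 * s) * (1 - v2 * s)] with v1, v2 in the closed disc
    reduces the claim to [bipolar_neq0]. *)
Lemma grace_cubic u1 u2 u3 a b c :
  normc u1 <= 1 -> normc u2 <= 1 -> normc u3 <= 1 ->
  normc a < 1 -> normc b < 1 -> normc c < 1 ->
  3 - (u1 + u2 + u3) * (a + b + c)
  + (u1 * u2 + u2 * u3 + u3 * u1) * (a * b + b * c + c * a)
  - 3 * (u1 * u2 * u3) * (a * b * c) != 0.
Proof.
move=> u11 u21 u31 a1 b1 c1.
pose p := 3 - (u1 + u2 + u3) * a.
pose q := u1 + u2 + u3 - (u1 * u2 + u2 * u3 + u3 * u1) * a.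
pose r := (u1 * u2 + u2 * u3 + u3 * u1) - 3 * (u1 * u2 * u3) * a.
have quad s : normc s < 1 -> p - 2 * q * s + r * s ^+ 2 != 0.
  move=> /(laguerre_cubic_neq0 u11 u21 u31 a1); congr (_ != 0).
  by rewrite /p /q /r; ring.
have p0 : p != 0.
  have := quad 0; rewrite normc0 ltr01 => /(_ isT).
  by rewrite expr0n !mulr0 subr0 addr0.
(* A nonzero root of the reversed quadratic is the inverse of a zero of the quadratic in [quad]. *)
have root_le1 v : p * v ^+ 2 - 2 * q * v + r = 0 -> normc v <= 1.
  move=> hv; rewrite leNgt; apply/negP => v1.
  have v0 : v != 0 by apply: contraTneq v1 => ->; rewrite normc0 ltr10.
  have : normc v^-1 < 1 by rewrite normcV invf_lt1 // (lt_trans ltr01).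
  move=> /quad /eqP; apply; apply: (mulIf (expf_neq0 2 v0)).
  by rewrite mul0r -hv; field.
pose d := sqrtc (q ^+ 2 - p * r).
have hd : d ^+ 2 = q ^+ 2 - p * r by apply: sqr_sqrtc.
have v1 : normc ((q + d) / p) <= 1.
  apply: root_le1; apply: (mulfI p0); rewrite mulr0.
  suff -> : p * (p * ((q + d) / p) ^+ 2 - 2 * q * ((q + d) / p) + r)
     = d ^+ 2 - (q ^+ 2 - p * r) by rewrite hd subrr.
  by field.
have v2 : normc ((q - d) / p) <= 1.
  apply: root_le1; apply: (mulfI p0); rewrite mulr0.
  suff -> : p * (p * ((q - d) / p) ^+ 2 - 2 * q * ((q - d) / p) + r)
     = d ^+ 2 - (q ^+ 2 - p * r) by rewrite hd subrr.
  by field.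
have := bipolar_neq0 v1 v2 b1 c1; apply: contra_neq => h.
apply: (mulfI p0); rewrite mulr0.
have -> : 0 = 2 * (p - q * (b + c) + r * (b * c)) :> R[i].
  apply/esym/eqP; rewrite mulf_eq0 [X in _ || X](_ : _ = true) ?orbT //.
  by apply/eqP; rewrite -h /p /q /r; ring.
transitivity (2 * (p - q * (b + c) + (q ^+ 2 - d ^+ 2) / p * (b * c))).
  by field.
by congr (_ * (_ + _ * _)); rewrite hd; field.
Qed.
End Grace.

(** * The dominant root *)

Section RealPart.
Variable R : rcfType.
Implicit Types a b c w t s r : R[i].

Lemma normc_le_sqr a b :
  (normc a <= normc b) = (normc a ^+ 2 <= normc b ^+ 2).
Proof. by rewrite ler_pXn2r // nnegrE normc_ge0. Qed.

Lemma normc_le1 a : (normc a <= 1) = (normc a ^+ 2 <= 1).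
Proof. by rewrite expr_le1 ?normc_ge0. Qed.

(** With p = Re a and N = |a|^2, b is the conjugate of a over N, so the disc conditions read N <= 2
    p and 1 <= 2 p. As p^2 <= N, this gives 1/2 <= p <= 2 and Re (a + b) = p + p/N <= p + 1/p <=
    5/2. *)
Lemma Re_add_inv_le a b : a * b = 1 -> normc (a - 1) <= 1 -> normc (b - 1) <= 1 ->
  complex.Re (a + b) <= 5 / 2.
Proof.
rewrite !normc_le1 !sqr_normcE.
case: a b => p q [p' q']; simpc => -[] /= h1 h2 ha hb.
have hN : (p ^+ 2 + q ^+ 2) * p' = p.
  have -> : (p ^+ 2 + q ^+ 2) * p' = p * (p * p' - q * q') + q * (p * q' + q * p').
    by ring.
  by rewrite h1 h2; ring.
have hM : (p ^+ 2 + q ^+ 2) * (p' ^+ 2 + q' ^+ 2) = 1.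
  have -> : (p ^+ 2 + q ^+ 2) * (p' ^+ 2 + q' ^+ 2)
     = (p * p' - q * q') ^+ 2 + (p * q' + q * p') ^+ 2 by ring.
  by rewrite h1 h2; ring.
have N0 : 0 < p ^+ 2 + q ^+ 2.
  rewrite lt_def addr_ge0 ?sqr_ge0 // andbT; apply/eqP => N0.
  by move: hM; rewrite N0 mul0r => /esym /eqP; rewrite oner_eq0.
have ha' : p ^+ 2 + q ^+ 2 <= 2 * p by lra.
have hb' : 1 <= 2 * p.
  have : (p ^+ 2 + q ^+ 2) * (p' ^+ 2 + q' ^+ 2) <= (p ^+ 2 + q ^+ 2) * (2 * p').
    by apply: ler_wpM2l; [exact: ltW | lra].
  by rewrite hM mulrCA hN.
have q2 := sqr_ge0 q.
have p2 : p <= 2 by nra.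
rewrite -(ler_pM2l N0) mulrDr hN.
nra.
Qed.

Lemma Re_le_half c : (normc c <= normc (1 - c)) = (2 * complex.Re c <= 1).
Proof.
rewrite normc_le_sqr !sqr_normcE; case: c => x y; simpc => /=.
by apply/idP/idP => ?; lra.
Qed.

End RealPart.

Section Dominant.
Variable R : realType.
Implicit Types mu t s r : R[i].
Local Notation markoff_cubic mu := ('X^3 - 3%:R *: 'X^2 + mu%:P).

Lemma markoff_cubicE mu s : (markoff_cubic mu).[s] = s ^+ 3 - 3 * s ^+ 2 + mu.
Proof. by rewrite !hornerE. Qed.

(** Dividing the cubic by X - t leaves X^2 - (3 - t) X + t (t - 3), whose roots s and r come from
    the quadratic formula. *)
Lemma dominant_rootP mu t : dominant_root (markoff_cubic mu) t ->
  exists s r, [/\ t + s + r = 3, t * s + s * r + r * t = 0, t * s * r = - mu,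
                  normc s <= normc t & normc r <= normc t].
Proof.
case=> /rootP; rewrite markoff_cubicE => ht dom.
pose d := sqrtc ((3 - t) ^+ 2 - 4 * (t * (t - 3))).
have hd : d ^+ 2 = (3 - t) ^+ 2 - 4 * (t * (t - 3)) by apply: sqr_sqrtc.
have emu : mu = - (t ^+ 3 - 3 * t ^+ 2) by rewrite -[LHS]subr0 -ht; ring.
have hsr : (3 - t + d) / 2 * ((3 - t - d) / 2) = t * (t - 3).
  transitivity (((3 - t) ^+ 2 - d ^+ 2) / 4); first by field.
  by rewrite hd; field.
have hroot s r : s + r = 3 - t -> s * r = t * (t - 3) -> normc s <= normc t.
  move=> h1 h2; apply: dom; apply/rootP; rewrite markoff_cubicE emu.
  have er : r = 3 - t - s by rewrite -h1; ring.
  move: h2; rewrite er => /eqP; rewrite -subr_eq0 => /eqP h2.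
  transitivity (- (s - t) * (s * (3 - t - s) - t * (t - 3))); first by ring.
  by rewrite h2 mulr0.
exists ((3 - t + d) / 2), ((3 - t - d) / 2); split.
- by field.
- transitivity (t * (3 - t) + (3 - t + d) / 2 * ((3 - t - d) / 2)); first by field.
  by rewrite hsr; ring.
- by rewrite -mulrA hsr emu; ring.
- by apply: (hroot _ ((3 - t - d) / 2)) => //; field.
- by apply: (hroot _ ((3 - t + d) / 2)); [field | rewrite mulrC].
Qed.

Lemma dominant_root_neq0 mu t : dominant_root (markoff_cubic mu) t -> t != 0.
Proof.
case/dominant_rootP=> s [r [h _ _ hs hr]]; apply: contra_eqN h => /eqP t0.
have z u : normc u <= normc t -> u = 0.
  rewrite t0 normc0 => u0; apply: eq0_normc; apply/eqP.
  by rewrite eq_le u0 normc_ge0.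
by rewrite t0 (z s hs) (z r hr) !addr0 eq_sym pnatr_eq0.
Qed.

Lemma dominant_root_sink mu t : dominant_root (markoff_cubic mu) t ->
  normc t <= normc (t * t - t).
Proof.
move=> dom; have t0 := dominant_root_neq0 dom.
case/dominant_rootP: dom => s [r [h1 h2 _ hs hr]].
have nt : 0 < normc t.
  by rewrite lt_def normc_ge0 andbT; apply: contra_neq t0 => /eq0_normc.
have ab : (t + s) / t * ((t + r) / t) = 1.
  apply: (mulfI (expf_neq0 2 t0)).
  transitivity (t ^+ 2 + (t * s + s * r + r * t)); first by field.
  by rewrite h2; ring.
have le1 u : normc u <= normc t -> normc ((t + u) / t - 1) <= 1.
  move=> hu; have -> : (t + u) / t - 1 = u / t by field.
  by rewrite normcM normcV ler_pdivrMr // mul1r.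
have := Re_add_inv_le ab (le1 _ hs) (le1 _ hr).
have -> : (t + s) / t + (t + r) / t = 3 / t + 1.
  by rewrite -h1; field.
(* Now Re w <= 3/2, so [w] is no farther from 0 than from 3, and [(3 - w) / w] is [t - 1]. *)
set w := 3 / t => hw.
have w0 : w != 0 by rewrite mulf_neq0 ?invr_eq0 // pnatr_eq0.
have nw : 0 < normc w.
  by rewrite lt_def normc_ge0 andbT; apply: contra_neq w0 => /eq0_normc.
have -> : t * t - t = t * ((3 - w) / w) by rewrite /w; field; rewrite t0.
rewrite !normcM normcV ler_peMr // ?normc_ge0 // ler_pdivlMr // mul1r.
rewrite normc_le_sqr !sqr_normcE; move: hw; case: (w) => x y.
rewrite -[3]/(3%:R) -[1]/(1%:R) -!(rmorph_nat (real_complex R)) /=; simpc => /= hw.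
lra.
Qed.

End Dominant.

(** * The smaller root of c^2 - c + e *)

Section SmallRoot.
Variable R : rcfType.
Implicit Types d s : R[i].

(** Since |s^2| + Re (s^2) = 2 (Re s)^2, the real part varies continuously with [d], although the
    root itself jumps across the negative real axis. *)
Lemma Re_sqrt_normc d s : s ^+ 2 = d -> 0 <= complex.Re s ->
  complex.Re s = Num.sqrt ((normc d + complex.Re d) / 2).
Proof.
move=> <- s0; have -> : (normc (s ^+ 2) + complex.Re (s ^+ 2)) / 2 = complex.Re s ^+ 2.
  rewrite normcM -expr2 sqr_normcE; case: (s) => x y; by simpc => /=; field.
by rewrite sqrtr_sqr ger0_norm.
Qed.

(* |c|^2 for the root c of smaller modulus of c^2 - c + e = 0, in terms of the
   discriminant d = 1 - 4 e; the formula shows that it is continuous in d. *)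
Definition small_root_sqr_norm d : R :=
  (1 - 2 * Num.sqrt ((normc d + complex.Re d) / 2) + normc d) / 4.

Lemma small_root_sqr_normE d s : s ^+ 2 = d -> 0 <= complex.Re s ->
  normc ((1 - s) / 2) ^+ 2 = small_root_sqr_norm d.
Proof.
move=> sd s0; rewrite /small_root_sqr_norm -(Re_sqrt_normc sd s0) -sd.
have -> : normc (s ^+ 2) = normc s ^+ 2 by rewrite normcM.
rewrite normcM exprMn normcV.
have -> : normc (2 : R[i]) = 2.
  by rewrite -[2]/(2%:R) -(rmorph_nat (real_complex R)) /= expr0n addr0 sqrtr_sqr ger0_norm.
by rewrite !sqr_normcE; case: (s) => x y; simpc => /=; field.
Qed.

End SmallRoot.

Section Homotopy.
Variable R : realType.
Implicit Types a b c d s w z : R[i].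

Lemma continuous_small_root (p q : {poly R}) :
  continuous (fun x : R => small_root_sqr_norm (Complex p.[x] q.[x])).
Proof.
move=> x; rewrite /small_root_sqr_norm /=.
have cp : p.[y] @[y --> x] --> p.[x] by exact: continuous_horner.
have cq : q.[y] @[y --> x] --> q.[x] by exact: continuous_horner.
have cn : Num.sqrt (p.[y] ^+ 2 + q.[y] ^+ 2) @[y --> x]
    --> Num.sqrt (p.[x] ^+ 2 + q.[x] ^+ 2).
  apply: continuous_cvg; first exact: sqrt_continuous.
  by apply: cvgD; apply: cvgM.
apply: cvgM; last exact: cvg_cst.
apply: cvgD => //; apply: cvgB; first exact: cvg_cst.
apply: cvgMl_tmp; apply: continuous_cvg; first exact: sqrt_continuous.
by apply: cvgM; [apply: cvgD | exact: cvg_cst].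
Qed.

Lemma small_root_homotopy (k : R) w z c : 0 < k ->
  c ^+ 2 - c + w - z = 0 -> normc c <= normc (1 - c) -> k <= normc c ->
  exists (x : R) b, [/\ 0 <= x <= 1, normc b = k &
    b ^+ 2 - b + (x%:C)%C * w - ((x ^+ 2)%:C)%C * z = 0].
Proof.
move=> k0 hc c_small kc.
pose d (x : R) : R[i] := 1 - 4 * ((x%:C)%C * w - ((x ^+ 2)%:C)%C * z).
pose p : {poly R} := 1 - 4%:P * ((complex.Re w)%:P * 'X - (complex.Re z)%:P * 'X ^+ 2).
pose q : {poly R} := - 4%:P * ((complex.Im w)%:P * 'X - (complex.Im z)%:P * 'X ^+ 2).
have dE x : d x = Complex p.[x] q.[x].
  rewrite /d /p /q !hornerE; case: (w) (z) => w1 w2 [z1 z2].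
  rewrite -[4]/(4%:R) -[1]/(1%:R) -!(rmorph_nat (real_complex R)) /=; simpc.
  by congr Complex; ring.
have sqrt_ge0 x : 0 <= complex.Re (sqrtc (d x)).
  by rewrite /sqrtc; case: (d x) => x1 x2; rewrite sqrtr_ge0.
have f0 : small_root_sqr_norm (d 0) = 0.
  rewrite -(@small_root_sqr_normE _ _ 1) ?ler01 //.
    by rewrite subrr mul0r normc0 expr0n.
  by rewrite /d expr0n !mul0r subr0 mulr0 subr0 expr1n.
(* [1 - 2 * c] squares to [d 1], and [c_small], that is Re c <= 1/2, makes its real part
   nonnegative. *)
have f1 : small_root_sqr_norm (d 1) = normc c ^+ 2.
  rewrite -(@small_root_sqr_normE _ _ (1 - 2 * c)).
  - by congr (normc _ ^+ 2); field.
  - rewrite /d expr1n !mul1r; apply/eqP; rewrite -subr_eq0; apply/eqP.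
    transitivity (4 * (c ^+ 2 - c + w - z)); first by ring.
    by rewrite hc mulr0.
  - move: c_small; rewrite Re_le_half; case: (c) => c1 c2.
    rewrite -[2]/(2%:R) -[1]/(1%:R) -!(rmorph_nat (real_complex R)) /=; simpc => /=.
    by move=> ?; lra.
have [| |x xI fx] := @IVT R (fun x => small_root_sqr_norm (d x)) 0 1 (k ^+ 2) ler01.
- apply: continuous_subspaceT.
  rewrite (_ : (fun x => _) = fun x => small_root_sqr_norm (Complex p.[x] q.[x])).
    exact: continuous_small_root.
  by apply: boolp.funext => x; rewrite dE.
- have kc2 : k ^+ 2 <= normc c ^+ 2 by rewrite ler_pXn2r // nnegrE ?normc_ge0 ?ltW.
  by rewrite f0 f1 min_l ?max_r ?sqr_ge0 // kc2.
exists x, ((1 - sqrtc (d x)) / 2); split; first by move: xI; rewrite in_itv.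
- move: fx; rewrite -(small_root_sqr_normE (sqr_sqrtc _) (sqrt_ge0 x)) => /eqP.
  by rewrite eqrXn2 ?normc_ge0 ?ltW // => /eqP.
- transitivity (((sqrtc (d x)) ^+ 2 - d x) / 4); last by rewrite sqr_sqrtc subrr mul0r.
  by move: (sqrtc _) => s; rewrite /d; field.
Qed.

End Homotopy.

(** * The inequality at a sink *)

Section SinkInequality.
Variable R : realType.
Implicit Types (mu t x y z a b c : R[i]) (k : R).
Local Notation markoff_cubic mu := ('X^3 - 3%:R *: 'X^2 + mu%:P).

Lemma normc_real k : 0 <= k -> normc (k%:C)%C = k.
Proof. by move=> k0; rewrite /= expr0n addr0 sqrtr_sqr ger0_norm. Qed.

(** Grace's theorem for 1 - 3 X + mu X^3 = (1 - t X)(1 - s X)(1 - r X): dividing the roots by |t|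
    puts them in the closed unit disc, and multiplying a, b, c by |t| < k puts these in the open
    one. *)
Lemma polar_markoff_cubic_neq0 mu t k a b c :
  dominant_root (markoff_cubic mu) t -> normc t < k ->
  normc a <= k^-1 -> normc b <= k^-1 -> normc c <= k^-1 ->
  1 - (a + b + c) + mu * (a * b * c) != 0.
Proof.
move=> dom tk ha hb hc; have t0 := dominant_root_neq0 dom.
have nt : 0 < normc t.
  by rewrite lt_def normc_ge0 andbT; apply: contra_neq t0 => /eq0_normc.
have [s [r [h1 h2 h3 hs hr]]] := dominant_rootP dom.
pose m : R[i] := ((normc t)%:C)%C.
have m0 : m != 0 by rewrite fmorph_eq0 gt_eqF.
have nm : normc m = normc t by apply: normc_real; apply: ltW.
have le1 u : normc u <= normc t -> normc (u / m) <= 1.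
  by move=> hu; rewrite normcM normcV nm ler_pdivrMr // mul1r.
have lt1 u : normc u <= k^-1 -> normc (u * m) < 1.
  move=> hu; rewrite normcM nm -ltr_pdivlMr // mul1r.
  by apply: le_lt_trans hu _; rewrite ltf_pV2 // posrE (lt_trans nt).
have := grace_cubic (le1 _ (lexx _)) (le1 _ hs) (le1 _ hr) (lt1 _ ha) (lt1 _ hb) (lt1 _ hc).
apply: contra_neq => h.
transitivity (3 - (t + s + r) * (a + b + c)
  + (t * s + s * r + r * t) * (a * b + b * c + c * a) - 3 * (t * s * r) * (a * b * c)).
  by field.
rewrite h1 h2 h3; transitivity (3 * (1 - (a + b + c) + mu * (a * b * c))); first by ring.
by rewrite h mulr0.
Qed.

Lemma sink_ratio_lt mu t x y z k :
  dominant_root (markoff_cubic mu) t -> normc t < k ->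
  k <= normc x -> k <= normc y ->
  x ^+ 2 + y ^+ 2 + z ^+ 2 - x * y * z = mu -> normc z <= normc (x * y - z) ->
  normc (z / (x * y)) < k^-1.
Proof.
move=> dom tk kx ky hmu hz; rewrite ltNge; apply/negP => hc.
have k0 : 0 < k by apply: le_lt_trans tk; apply: normc_ge0.
have neq0 u : k <= normc u -> u != 0.
  by move=> ku; apply: contraTneq ku => ->; rewrite normc0 -ltNge.
have x0 := neq0 x kx; have y0 := neq0 y ky.
have nxy : 0 < (normc (x * y))^-1.
  by rewrite invr_gt0 normcM mulr_gt0 // (lt_le_trans k0).
(* The quadratic for [z / (x * y)] is the vertex relation divided by (x y)^2. *)
have [||||v [b [/andP[v0 v1] nb hb]]] := @small_root_homotopy R k^-1
    (x ^- 2 + y ^- 2) (mu / (x ^+ 2 * y ^+ 2)) (z / (x * y)).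
- by rewrite invr_gt0.
- by rewrite -hmu; field; rewrite x0 y0.
- have -> : 1 - z / (x * y) = (x * y - z) / (x * y) by field; rewrite x0 y0.
  by rewrite normcM normcV [leRHS]normcM normcV ler_pM2r.
- exact: hc.
have b0 : b != 0.
  by apply: contraTneq k0 => b0; rewrite -[k]invrK -nb b0 normc0 invr0 ltxx.
(* As |b| = 1/k, the modulus is v k / |u|^2 <= 1/k. The weights v and v^2 of the deformation make
   [b] times the polar form at this triple the negated quadratic of [hb]. *)
have le u : k <= normc u -> normc ((v%:C)%C / (b * u ^+ 2)) <= k^-1.
  move=> ku; have u0 : 0 < normc u by apply: lt_le_trans ku.
  rewrite normcM normcV normc_real // normcM nb normcM.
  rewrite ler_pdivrMr ?mulr_gt0 ?invr_gt0 //; apply: le_trans v1 _.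
  have uk : 1 <= normc u / k by rewrite ler_pdivlMr // mul1r.
  rewrite (_ : k^-1 * _ = (normc u / k) * (normc u / k)); last by field; rewrite gt_eqF.
  by nra.
have nbk : normc b <= k^-1 by rewrite nb.
have /eqP := polar_markoff_cubic_neq0 dom tk (le x kx) (le y ky) nbk; apply.
apply: (mulfI b0); rewrite mulr0.
transitivity (- (b ^+ 2 - b + (v%:C)%C * (x ^- 2 + y ^- 2)
   - ((v ^+ 2)%:C)%C * (mu / (x ^+ 2 * y ^+ 2)))).
  by rewrite rmorphXn; field; rewrite x0 y0 b0.
by rewrite hb oppr0.
Qed.

Lemma sink_min_le mu t x y z :
  dominant_root (markoff_cubic mu) t ->
  x ^+ 2 + y ^+ 2 + z ^+ 2 - x * y * z = mu ->
  normc x <= normc (y * z - x) -> normc y <= normc (x * z - y) ->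
  normc z <= normc (x * y - z) ->
  Num.min (normc x) (Num.min (normc y) (normc z)) <= normc t.
Proof.
move=> dom hmu hx hy hz; rewrite leNgt; apply/negP.
set k := Num.min _ _ => tk.
have kx : k <= normc x by rewrite ge_min lexx.
have ky : k <= normc y by rewrite !ge_min lexx orbT.
have kz : k <= normc z by rewrite !ge_min lexx !orbT.
have k0 : 0 < k by apply: le_lt_trans tk; apply: normc_ge0.
have neq0 u : k <= normc u -> u != 0.
  by move=> ku; apply: contraTneq ku => ->; rewrite normc0 -ltNge.
have x0 := neq0 x kx; have y0 := neq0 y ky; have z0 := neq0 z kz.
have ha : normc (x / (y * z)) < k^-1.
  by apply: sink_ratio_lt dom tk ky kz _ hx; rewrite -hmu; ring.
have hb : normc (y / (x * z)) < k^-1.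
  by apply: sink_ratio_lt dom tk kx kz _ hy; rewrite -hmu; ring.
have hc : normc (z / (x * y)) < k^-1 by apply: sink_ratio_lt dom tk kx ky hmu hz.
have /eqP := polar_markoff_cubic_neq0 dom tk (ltW ha) (ltW hb) (ltW hc); apply.
by rewrite -hmu; field; rewrite x0 y0.
Qed.
End SinkInequality.

(** * Markoff maps with prescribed values at a vertex *)

Section FareyLabel.
Variable K : comNzRingType.
Implicit Types x y z : K.

(* The label of the primitive vector (a, b) of the first quadrant when (1, 0),
   (0, 1) and (1, 1) are labelled x, y and z.  A step of the subtractive Euclidean
   algorithm replaces the basis by (1, 0), (1, 1) or by (1, 1), (0, 1), and the
   edge relation gives the label of the sum of the new basis.  [n] is fuel. *)
Fixpoint cone_label_rec (n a b : nat) x y z : K :=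
  if n is n'.+1 then
    if a == 0%N then y else if b == 0%N then x
    else if (b <= a)%N then cone_label_rec n' (a - b) b x z (x * z - y)
    else cone_label_rec n' a (b - a) z y (z * y - x)
  else y.

Definition cone_label (a b : nat) x y z := cone_label_rec (a + b) a b x y z.

Lemma cone_label_recS n a b x y z : cone_label_rec n.+1 a b x y z =
  if a == 0%N then y else if b == 0%N then x
  else if (b <= a)%N then cone_label_rec n (a - b) b x z (x * z - y)
  else cone_label_rec n a (b - a) z y (z * y - x).
Proof. by []. Qed.

(** Each Euclidean step lowers a + b. Fuel can only be 0 here when a = 0, and the default [y] is
    then the right value. *)
Lemma cone_label_recE n a b x y z : (a + b <= n)%N ->
  cone_label_rec n a b x y z = cone_label a b x y z.
Proof.
suff rec_eq m : (a + b <= n -> a + b <= m ->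
    cone_label_rec n a b x y z = cone_label_rec m a b x y z)%N.
  by move=> nab; apply: rec_eq.
elim: n m a b x y z => [|n IH] [|m] a b x y z //=.
- by rewrite leqn0 addn_eq0 => /andP[/eqP->].
- by move=> _; rewrite leqn0 addn_eq0 => /andP[/eqP->].
move=> ? ?; case: eqP => // a0; case: eqP => // b0.
by case: ifP => ab; apply: IH; lia.
Qed.

Lemma cone_label0l b x y z : cone_label 0 b x y z = y.
Proof. by case: b. Qed.

Lemma cone_label0r a x y z : (0 < a)%N -> cone_label a 0 x y z = x.
Proof. by case: a. Qed.

(** Change of basis: (a + b, b) = a (1, 0) + b (1, 1). At a = b = 0 the two sides would be [y] and
    [z]. *)
Lemma cone_labelDl a b x y z : (0 < a + b)%N ->
  cone_label (a + b) b x y z = cone_label a b x z (x * z - y).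
Proof.
case: b => [|b] ab; first by rewrite addn0 in ab *; rewrite !cone_label0r.
rewrite -(@cone_label_recE (a + b.+1 + b).+1); last by lia.
rewrite cone_label_recS addn_eq0 andbF leq_addl addnK.
by rewrite cone_label_recE //; lia.
Qed.

Lemma cone_labelDr a b x y z : (0 < a + b)%N ->
  cone_label a (a + b) x y z = cone_label a b z y (z * y - x).
Proof.
case: a => [|a] ab; first by rewrite !cone_label0l.
rewrite -(@cone_label_recE (a.+1 + b + a).+1); last by lia.
rewrite cone_label_recS; case: b ab => [|b] ab.
  (* On the diagonal the algorithm takes the other branch, but both sides are the label [z] of (1,
     1). *)
  by rewrite addn0 leqnn subnn cone_label0r // cone_label_recE ?cone_label0l.
by rewrite (ifN _ _ (_ : ~~ (_ <= _)%N)) ?addKn ?cone_label_recE //; lia.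
Qed.

(** Adjacent vectors on one side of the diagonal are brought to smaller ones by a change of basis,
    under which x^2 + y^2 + z^2 - x y z is invariant. The edge between (a, b) and (a + c, b + d) is
    used for the second relation to avoid subtraction. *)
Lemma cone_label_relations a b c d x y z :
  (a * d = b * c + 1 \/ b * c = a * d + 1)%N ->
  let l p q := cone_label p q x y z in
  l a b ^+ 2 + l c d ^+ 2 + l (a + c)%N (b + d)%N ^+ 2
    - l a b * l c d * l (a + c)%N (b + d)%N
    = x ^+ 2 + y ^+ 2 + z ^+ 2 - x * y * z
  /\ l (a + (a + c))%N (b + (b + d))%N + l c d = l a b * l (a + c)%N (b + d)%N.
Proof.
have [n] := ubnP (a + b + c + d)%N.
elim: n a b c d x y z => // n IH a b c d x y z hn hdet.
have [/andP[ab cd]|le1] := boolP ((b <= a) && (d <= c))%N.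
  have [a' ea] : exists a', a = (a' + b)%N by exists (a - b)%N; lia.
  have [c' ec] : exists c', c = (c' + d)%N by exists (c - d)%N; lia.
  subst a c; have h : (a' * d = b * c' + 1 \/ b * c' = a' * d + 1)%N by lia.
  have := IH a' b c' d x z (x * z - y); case; [nia | exact: h |] => /=.
  rewrite (_ : a' + b + (a' + b + (c' + d)) = a' + (a' + c') + (b + (b + d)))%N; last by lia.
  rewrite (_ : a' + b + (c' + d) = a' + c' + (b + d))%N; last by lia.
  by rewrite !cone_labelDl; [move=> -> ->; split=> //; ring | nia ..].
have [/andP[ab cd]|le2] := boolP ((a <= b) && (c <= d))%N.
  have [b' eb] : exists b', b = (a + b')%N by exists (b - a)%N; lia.
  have [d' ed] : exists d', d = (c + d')%N by exists (d - c)%N; lia.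
  subst b d; have h : (a * d' = b' * c + 1 \/ b' * c = a * d' + 1)%N by lia.
  have := IH a b' c d' z y (z * y - x); case; [nia | exact: h |] => /=.
  rewrite (_ : a + b' + (a + b' + (c + d')) = a + (a + c) + (b' + (b' + d')))%N; last by lia.
  rewrite (_ : a + b' + (c + d') = a + c + (b' + d'))%N; last by lia.
  by rewrite !cone_labelDr; [move=> -> ->; split=> //; ring | nia ..].
(* If b < a and c < d, then a d - b c >= (b + 1)(c + 1) - b c = b + c + 1, so b = c = 0. *)
have [[-> -> -> ->]|[-> -> -> ->]] : [/\ a = 1, b = 0, c = 0 & d = 1]%N \/
    [/\ a = 0, b = 1, c = 1 & d = 0]%N.
- have [lt_ba|le_ab] := ltnP b a; [left | right]; split; nia.
- by split; rewrite /cone_label /=; ring.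
- by split; rewrite /cone_label /=; ring.
Qed.

(* In the second quadrant use the basis (-1, 0), (0, 1), whose sum (-1, 1) is
   labelled x y - z by the edge relation. *)
Definition farey_label (p q : int) x y z : K :=
  if 0 <= p * q then cone_label `|p| `|q| x y z
  else cone_label `|p| `|q| x y (x * y - z).

Lemma farey_label_nat (a b : nat) x y z : farey_label a b x y z = cone_label a b x y z.
Proof. by rewrite /farey_label -PoszM le0z_nat. Qed.

Lemma farey_label_opp p q x y z : farey_label (- p) (- q) x y z = farey_label p q x y z.
Proof. by rewrite /farey_label mulrNN !abszN. Qed.

(** Off the axes the reflection swaps the quadrants, hence [z] and [x * y - z]; on the axes the
    third label is irrelevant. *)
Lemma farey_label_reflect p q x y z :
  farey_label (- p) q x y z = farey_label p q x y (x * y - z).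
Proof.
rewrite /farey_label mulNr abszN oppr_ge0 subKr.
have [->|q0] := eqVneq q 0.
  rewrite mulr0 lexx; case: `|p|%N => [|a]; first by rewrite !cone_label0l.
  by rewrite !cone_label0r.
have [->|p0] := eqVneq p 0; first by rewrite mul0r lexx !cone_label0l.
by have [] := ltgtP (p * q) 0 => // /eqP; rewrite mulf_eq0 (negPf p0) (negPf q0).
Qed.

(** The regions at the two ends of the edge between (p, q) and (r, s) are the sum and the difference
    of these vectors. *)
Definition farey_relations (p q r s : int) x y z : Prop :=
  farey_label p q x y z ^+ 2 + farey_label r s x y z ^+ 2
    + farey_label (p + r) (q + s) x y z ^+ 2
    - farey_label p q x y z * farey_label r s x y z * farey_label (p + r) (q + s) x y z
    = x ^+ 2 + y ^+ 2 + z ^+ 2 - x * y * z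
  /\ farey_label (p + r) (q + s) x y z + farey_label (p - r) (q - s) x y z
    = farey_label p q x y z * farey_label r s x y z.

(** If one vector dominates the other coordinatewise, [cone_label_relations] applies to the smaller
    one and the difference; otherwise the pair is the standard basis. *)
Lemma farey_relations_nat (a b c d : nat) x y z :
  `|a%:Z * d%:Z - b%:Z * c%:Z| = 1 -> farey_relations a b c d x y z.
Proof.
move=> hdet; have h : (a * d = b * c + 1 \/ b * c = a * d + 1)%N by lia.
split; first by rewrite -!PoszD !farey_label_nat; have [] := cone_label_relations x y z h.
have [/andP[ca db]|le1] := boolP ((c <= a) && (d <= b))%N.
  have [a' ea] : exists a', a = (a' + c)%N by exists (a - c)%N; lia.
  have [b' eb] : exists b', b = (b' + d)%N by exists (b - d)%N; lia.
  subst a b; have h' : (c * b' = d * a' + 1 \/ d * a' = c * b' + 1)%N by lia.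
  rewrite !PoszD !addrK -!PoszD !farey_label_nat.
  have [_] := cone_label_relations x y z h'.
  by rewrite [X in _ -> _ = X]mulrC (addnC a') (addnC b') (addnC (c + a')) (addnC (d + b')).
have [/andP[ac bd]|le2] := boolP ((a <= c) && (b <= d))%N.
  have [c' ec] : exists c', c = (a + c')%N by exists (c - a)%N; lia.
  have [d' ed] : exists d', d = (b + d')%N by exists (d - b)%N; lia.
  subst c d; have h' : (a * d' = b * c' + 1 \/ b * c' = a * d' + 1)%N by lia.
  rewrite -[X in _ + X = _]farey_label_opp !opprB ![Posz (_ + _)]PoszD.
  rewrite [X in _ + farey_label X _ _ _ _]addrC addKr.
  rewrite [X in _ + farey_label _ X _ _ _]addrC addKr -!PoszD !farey_label_nat.
  by have [_] := cone_label_relations x y z h'.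
have [[-> -> -> ->]|[-> -> -> ->]] : [/\ a = 1, b = 0, c = 0 & d = 1]%N \/
    [/\ a = 0, b = 1, c = 1 & d = 0]%N.
- have [lt_ba|le_ab] := ltnP b a; [left | right]; split; nia.
- by rewrite /farey_label /cone_label /=; ring.
- by rewrite /farey_label /cone_label /=; ring.
Qed.

Lemma farey_relations_sym p q r s x y z :
  farey_relations r s p q x y z -> farey_relations p q r s x y z.
Proof.
rewrite /farey_relations => -[h1 h2]; split.
  by rewrite -h1 (addrC r) (addrC s); ring.
by rewrite -(farey_label_opp (p - r)) !opprB (addrC p) (addrC q) h2 mulrC.
Qed.

Lemma farey_relations_opp p q r s x y z :
  farey_relations p q r s x y z -> farey_relations p q (- r) (- s) x y z.
Proof.
rewrite /farey_relations !opprK farey_label_opp => -[<- h]; split; last by rewrite addrC.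
have -> : farey_label (p - r) (q - s) x y z
  = farey_label p q x y z * farey_label r s x y z - farey_label (p + r) (q + s) x y z.
  by rewrite -h addrAC subrr add0r.
by ring.
Qed.

Lemma farey_relations_reflect p q r s x y z :
  farey_relations p q r s x y (x * y - z) -> farey_relations (- p) q (- r) s x y z.
Proof.
rewrite /farey_relations -!opprD !farey_label_reflect => -[-> ->].
by split=> //; ring.
Qed.

Lemma farey_relations_upper (p q r s : int) x y z : 0 <= q -> 0 <= s ->
  `|p * s - q * r| = 1 -> farey_relations p q r s x y z.
Proof.
have natE (a : int) : 0 <= a -> exists n : nat, a = n by exists `|a|%N; lia.
have pos a b c d x' y' z' : 0 <= a -> 0 <= b -> 0 <= c -> 0 <= d ->
    `|a * d - b * c| = 1 -> farey_relations a b c d x' y' z'.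
  move=> /natE[a' ->] /natE[b' ->] /natE[c' ->] /natE[d' ->].
  exact: farey_relations_nat.
have neg a b c d x' y' z' : a <= 0 -> 0 <= b -> c <= 0 -> 0 <= d ->
    `|a * d - b * c| = 1 -> farey_relations a b c d x' y' z'.
  move=> a0 b0 c0 d0 h; rewrite -(opprK a) -(opprK c).
  by apply: farey_relations_reflect; apply: pos; lia.
have mix a b c d x' y' z' : 0 < a -> 0 <= b -> c < 0 -> 0 <= d ->
    `|a * d - b * c| = 1 -> farey_relations a b c d x' y' z'.
  (* a d and - b c are nonnegative with sum 1, so b or d is 0; negating that horizontal vector moves
     it to the quadrant of the other. *)
  move=> a0 b0 c0 d0 h; have [b1|b1] := eqVneq b 0.
    apply: farey_relations_sym; rewrite -(opprK a) -(opprK b).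
    apply: farey_relations_opp; apply: neg; lia.
  have d1 : d = 0 by nia.
  rewrite -(opprK c) -(opprK d).
  by apply: farey_relations_opp; apply: pos; lia.
move=> q0 s0 h; case: (lerP 0 p) (lerP 0 r) => p0 [] r0.
- exact: pos.
- have [p00|p00] := eqVneq p 0; first by apply: neg => //; lia.
  by apply: mix => //; lia.
- have [r00|r00] := eqVneq r 0; first by apply: neg => //; lia.
  by apply: farey_relations_sym; apply: mix => //; lia.
- by apply: neg => //; lia.
Qed.

End FareyLabel.

(** * Regions as primitive vectors up to sign *)

Section Regions.
Implicit Types X Y Z W : region.

Lemma region_den_ge0 X : 0 <= region_den X.
Proof. by case: X => [q|] //=; apply: denq_ge0. Qed.

Lemma region_inj X Y :
  region_num X = region_num Y -> region_den X = region_den Y -> X = Y.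
Proof.
case: X Y => [p|] [q|] //= hn hd.
- by congr Some; rewrite -(divq_num_den p) -(divq_num_den q) hn hd.
- by have := denq_neq0 p; rewrite hd.
- by have := denq_neq0 q; rewrite -hd.
Qed.

Lemma region_inj_opp X Y :
  region_num X = - region_num Y -> region_den X = - region_den Y -> X = Y.
Proof.
move=> hn hd; have hX := region_den_ge0 X; have hY := region_den_ge0 Y.
have [dX dY] : region_den X = 0 /\ region_den Y = 0 by split; lia.
case: X Y dX dY {hn hd hX hY} => [p|] [q|] //= dX dY.
- by have := denq_neq0 p; rewrite dX.
- by have := denq_neq0 p; rewrite dX.
- by have := denq_neq0 q; rewrite dY.
Qed.

Lemma region_of_primitive (p q r s : int) : `|p * s - q * r| = 1 ->
  exists X, (region_num X = p /\ region_den X = q)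
         \/ (region_num X = - p /\ region_den X = - q).
Proof.
move=> hdet; have [q0|q0] := eqVneq q 0.
  exists None => /=; move: hdet; rewrite q0 mul0r subr0 => hps.
  have : (`|p| * `|s| == 1)%N by rewrite -abszM; lia.
  rewrite muln_eq1 => /andP[/eqP p1' _].
  have [p1|p1] : p = 1 \/ p = -1 by lia.
    by left; rewrite p1.
  by right; rewrite p1.
have cop : coprime `|p| `|q|.
  apply/coprimezP; have [hd|hd] : p * s - q * r = 1 \/ p * s - q * r = - 1 by lia.
    by exists (s, - r) => /=; rewrite -hd; ring.
  by exists (- s, r) => /=; rewrite -[RHS]opprK -hd; ring.
exists (Some (p%:~R / q%:~R)) => /=.
rewrite coprimeq_num // coprimeq_den // (negPf q0).
have [lt|gt|e] := ltgtP q 0; last by rewrite e eqxx in q0.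
- by right; rewrite ltr0_sg // ltr0_norm //; split => //; lia.
- by left; rewrite gtr0_sg // gtr0_norm // mul1r.
Qed.

Lemma third_vertex (p q r s m n : int) :
  `|p * s - q * r| = 1 -> `|r * n - s * m| = 1 -> `|p * n - q * m| = 1 ->
  [\/ m = p + r /\ n = q + s, m = - (p + r) /\ n = - (q + s),
      m = p - r /\ n = q - s | m = - (p - r) /\ n = - (q - s)].
Proof.
move=> hD hB hA.
(* Cramer's rule: the coordinates of (m, n) in the basis (p, q), (r, s) are 1 or -1. *)
have em : m * (p * s - q * r) = r * (p * n - q * m) - p * (r * n - s * m) by ring.
have en : n * (p * s - q * r) = s * (p * n - q * m) - q * (r * n - s * m) by ring.
move: (p * s - q * r) (r * n - s * m) (p * n - q * m) hD hB hA em en => D B A.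
have pm (E : int) : `|E| = 1 -> E = 1 \/ E = -1 by lia.
move=> /pm [->|->] /pm [->|->] /pm [->|->] em en.
all: try by apply: Or41; lia.
all: try by apply: Or42; lia.
all: try by apply: Or43; lia.
all: by apply: Or44; lia.
Qed.

Lemma meet_at_vertex_third X Y W : meet_at_vertex X Y W ->
  let p := region_num X in let q := region_den X in
  let r := region_num Y in let s := region_den Y in
  let m := region_num W in let n := region_den W in
  [\/ m = p + r /\ n = q + s, m = - (p + r) /\ n = - (q + s),
      m = p - r /\ n = q - s | m = - (p - r) /\ n = - (q - s)].
Proof. by case=> hXY hYW hXW /=; apply: third_vertex. Qed.

(** This keeps the arrow conditions of [sink] from being vacuous. Up to sign [W] is the sum or the
    difference of [X] and [Y]; [Z] is the other one. *)
Lemma tree_edge_opposite X Y W : meet_at_vertex X Y W -> exists Z, tree_edge X Y Z W.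
Proof.
move=> hW; have := meet_at_vertex_third hW; case: (hW) => hXY _ _.
rewrite /tree_edge; move: hXY; rewrite /meet_at_vertex /share_edge.
set p := region_num X; set q := region_den X.
set r := region_num Y; set s := region_den Y => hdet hWE.
have nz : ~ (p = 0 /\ q = 0) /\ ~ (r = 0 /\ s = 0).
  by split=> -[e1 e2]; move: hdet; rewrite e1 e2 ?mul0r ?mulr0 subrr.
have [Z hZ] : exists Z,
    [\/ region_num Z = p - r /\ region_den Z = q - s,
        region_num Z = - (p - r) /\ region_den Z = - (q - s),
        region_num Z = p + r /\ region_den Z = q + s
      | region_num Z = - (p + r) /\ region_den Z = - (q + s)] /\ Z <> W.
  have h1 : `|(p - r) * s - (q - s) * r| = 1 by rewrite -hdet; congr `|_|; ring.
  have h2 : `|(p + r) * s - (q + s) * r| = 1 by rewrite -hdet; congr `|_|; ring.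
  have [Z1 hZ1] := region_of_primitive h1; have [Z2 hZ2] := region_of_primitive h2.
  have sep Z : Z = W -> region_num Z = region_num W /\ region_den Z = region_den W.
    by move=> ->.
  case: hWE => hWE; [exists Z1 | exists Z1 | exists Z2 | exists Z2]; split.
  all: try by move=> /sep; lia.
  - by case: hZ1; [constructor 1 | constructor 2].
  - by case: hZ1; [constructor 1 | constructor 2].
  - by case: hZ2; [constructor 3 | constructor 4].
  - by case: hZ2; [constructor 3 | constructor 4].
case: hZ => hZ ZW; exists Z; split => //; split => //; rewrite -/p -/q -/r -/s.
- by case: hZ => -[-> ->]; lia.
- by case: hZ => -[-> ->]; lia.
Qed.
End Regions.

(** * The Markoff map extending a vertex labelling *)

Section Extension.
Variable R : realType.
Implicit Types x y z : R[i].

Definition farey_map x y z (X : region) : R[i] :=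
  farey_label (region_num X) (region_den X) x y z.

Lemma farey_map_opp x y z (X : region) (m n : int) :
  region_num X = m /\ region_den X = n \/ region_num X = - m /\ region_den X = - n ->
  farey_map x y z X = farey_label m n x y z.
Proof. by rewrite /farey_map; case=> -[-> ->] //; rewrite farey_label_opp. Qed.

(** The third region at a vertex is a sum or a difference, and the vertex relation is invariant
    under exchanging their labels; two distinct ends of an edge are one of each. *)
Lemma farey_map_markoff x y z :
  markoff_map (x ^+ 2 + y ^+ 2 + z ^+ 2 - x * y * z) (farey_map x y z).
Proof.
split=> [X Y W hW|X Y Z W [hZ hW ZW]].
  have [hXY _ _] := hW.
  have := farey_relations_upper x y z (region_den_ge0 X) (region_den_ge0 Y) hXY.
  case=> h1 h2; have e : forall t, farey_map x y z W = t ->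
      t = farey_label (region_num X + region_num Y) (region_den X + region_den Y) x y z
   \/ t = farey_map x y z X * farey_map x y z Y
         - farey_label (region_num X + region_num Y) (region_den X + region_den Y) x y z.
    move=> _ <-; rewrite /farey_map -h2.
    case: (meet_at_vertex_third hW) => h.
    - by left; apply: farey_map_opp; left.
    - by left; apply: farey_map_opp; right.
    - by right; rewrite addrAC subrr add0r; apply: farey_map_opp; left.
    - by right; rewrite addrAC subrr add0r; apply: farey_map_opp; right.
  by case: (e _ erefl) => ->; rewrite -h1 /farey_map //; ring.
have [hXY _ _] := hZ.
have := farey_relations_upper x y z (region_den_ge0 X) (region_den_ge0 Y) hXY.
move=> -[_]; rewrite /farey_map => <-.
have same m n : (region_num Z = m /\ region_den Z = n \/ region_num Z = - m /\ region_den Z = - n)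
   -> (region_num W = m /\ region_den W = n \/ region_num W = - m /\ region_den W = - n) -> False.
  by move=> [] [h1 h2] [] [h3 h4]; apply: ZW; (apply: region_inj; lia) || (apply: region_inj_opp; lia).
have third V : meet_at_vertex X Y V ->
    (region_num V = region_num X + region_num Y /\ region_den V = region_den X + region_den Y \/
     region_num V = - (region_num X + region_num Y) /\ region_den V = - (region_den X + region_den Y))
 \/ (region_num V = region_num X - region_num Y /\ region_den V = region_den X - region_den Y \/
     region_num V = - (region_num X - region_num Y) /\ region_den V = - (region_den X - region_den Y)).
  by case/meet_at_vertex_third; tauto.
have [h1|h1] := third _ hZ; have [h2|h2] := third _ hW.
- by case: (same _ _ h1 h2).
- by rewrite -(farey_map_opp x y z h1) -(farey_map_opp x y z h2).
- by rewrite -(farey_map_opp x y z h1) -(farey_map_opp x y z h2) addrC.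
- by case: (same _ _ h1 h2).
Qed.
End Extension.

(** * Bounds for the sink constant *)

Lemma sink_arrow (R : realType) (phi : region -> R[i]) (mu : R[i]) (X Y W : region) :
  markoff_map mu phi -> meet_at_vertex X Y W ->
  (forall Z, tree_edge X Y Z W -> arrow_towards phi X Y Z W) ->
  normc (phi W) <= normc (phi X * phi Y - phi W).
Proof.
move=> [_ edge] hW arrow; have [Z hZ] := tree_edge_opposite hW.
by have [_] := arrow Z hZ; rewrite -(edge _ _ _ _ hZ) addrK.
Qed.

Lemma share_edge_sym (X Y : region) : share_edge X Y -> share_edge Y X.
Proof. by rewrite /share_edge => <-; rewrite distrC; congr `|_|; ring. Qed.

Lemma sink_constant_upper (R : realType) (mu t : R[i]) :
  dominant_root ('X^3 - 3%:R *: 'X^2 + mu%:P) t -> sink_bounds mu (normc t).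
Proof.
move=> dom phi X1 X2 X3 hphi [[h12 h23 h13] a3 a1 a2].
have h21 := share_edge_sym h12; have h32 := share_edge_sym h23.
have h31 := share_edge_sym h13.
apply: (sink_min_le dom); first by apply: hphi.1.
- exact: sink_arrow hphi _ a1.
- exact: sink_arrow hphi _ a2.
- exact: sink_arrow hphi _ a3.
Qed.

Lemma sink_constant_lower (R : realType) (mu t : R[i]) :
  dominant_root ('X^3 - 3%:R *: 'X^2 + mu%:P) t -> lbound (sink_bounds mu) (normc t).
Proof.
move=> dom m hm; have [/rootP ht _] := dom.
have hphi : markoff_map mu (farey_map t t t).
  rewrite (_ : mu = t ^+ 2 + t ^+ 2 + t ^+ 2 - t * t * t); first exact: farey_map_markoff.
  by apply/eqP; rewrite -subr_eq0 -ht markoff_cubicE; apply/eqP; ring.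
have e1 : farey_map t t t None = t by [].
have e2 : farey_map t t t (Some 0) = t by [].
have e3 : farey_map t t t (Some 1) = t by [].
(* The sink is the vertex of oo, 0 and 1; each region opposite to it has label t^2 - t. *)
have := hm _ None (Some 0) (Some 1) hphi; rewrite e1 e2 e3 !minxx; apply.
have arrow X Y Z W : farey_map t t t X = t -> farey_map t t t Y = t ->
    farey_map t t t W = t -> tree_edge X Y Z W -> arrow_towards (farey_map t t t) X Y Z W.
  move=> eX eY eW hZ; split=> //; have := hphi.2 _ _ _ _ hZ.
  rewrite eX eY eW => hsum; have -> : farey_map t t t Z = t * t - t by rewrite -hsum addrK.
  exact: dominant_root_sink dom.
by split=> // Z; apply: arrow.
Qed.

Theorem theorem1 (R : realType) (mu t : R[i])
  (ht : dominant_root ('X^3 - 3%:R *: 'X^2 + mu%:P) t) :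
  is_sink_constant mu (normc t).
Proof.
split; [exact: sink_constant_upper ht | exact: sink_constant_lower ht].
Qed.
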